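(* For every $n$ there are strings $x,y\in2^n$ and $x',y'\in2^n$ for which the same $P$ is a minimal length conditional sufficient statistic (both of $(x,y)$ and of $(x',y')$), such that $$EIT(x\leftarrow y)=^+0,\qquad EIT(x'\leftarrow y')=^+n-\log n,$$ $$EIT(y\leftarrow x)=^+n-\log n,\qquad EIT(y'\leftarrow x')=^+0 .$$ Here $=^+$ denotes equality up to an additive constant independent of $n$.
   Context: $\log$ is base 2; $2^n$ is the set of binary strings of length $n$; $x^i=x_1\dots x_i$. Semimeasures are length conditional: non-negative functions with $\sum_{x\in2^n}P(x)\le1$, resp. (conditional) $\sum_{x\in2^n}P(x|y)\le1$ for every $y\in2^n$, for every $n$. A function is enumerable if it is the limit of a computable nondecreasing sequence of rational functions. A universal element of a set of semimeasures is an element of the set that dominates every element of the set up to a multiplicative constant. $m(x)$ is a universal enumerable semimeasure. For a conditional semimeasure put $P(x^i|y)=\sum_{v\in2^{n-i}}P(x^iv|y)$; $P(x|y)$ is causal if it equals $P(x|y\uparrow)=\prod_{i\le n}P(x_i|x^{i-1},y^{i-1})$, i.e. if for all $i\le n$ the quantity $P(x^i|y)$ depends on $y$ only through $y^{i-1}$. $m(x|y\uparrow)$ is a universal element of the set of enumerable causal conditional semimeasures. The enumerable information transfer is $$EIT(x\leftarrow y)=\log\frac{m(x|y\uparrow)}{m(x)},$$ and $EIT(y\leftarrow x)$ is defined with the roles exchanged. $K$ is prefix-free Kolmogorov complexity with respect to a fixed optimal universal prefix-free machine that is always given $n$ as an additional input (length conditional complexity). A (probabilistic, length conditional) sufficient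 statistic of $(x,y)\in2^n\times2^n$ is a computable probability distribution $P$ on $2^n\times 2^n$ with $K(P)-\log P(x,y)=^+K(x,y)$, where $K(P)$ is the length of a shortest program computing $P$; it is minimal if $K(P)$ is minimal, up to an additive constant, among all sufficient statistics of $(x,y)$. *)

(* Defs.v *)
From Stdlib Require List.
From mathcomp Require Import all_boot all_order all_algebra.
From mathcomp Require Import all_classical all_reals all_analysis.

Set Implicit Arguments.
Unset Strict Implicit.
Unset Printing Implicit Defensive.

Import Order.TTheory GRing.Theory Num.Theory.
Import numFieldNormedType.Exports.

Local Open Scope classical_set_scope.
Local Open Scope ring_scope.

(* Model of computation: Kleene's partial recursive functions.  A program is
   run on a list of naturals of any length; missing arguments read as 0. *)
Inductive prog : Type :=
| RZero
| RSucc
| RProj of nat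
| RComp of prog & seq prog
| RPrec of prog & prog
| RMin of prog.

Fixpoint prec_graph (F G : seq nat -> nat -> Prop) (t : seq nat) (k v : nat)
    : Prop :=
  match k with
  | 0%N => F t v
  | k'.+1 => exists2 r, prec_graph F G t k' r & G [:: k', r & t] v
  end.

(* [run e s v]: the program [e] halts on the arguments [s] with output [v]. *)
Fixpoint run (e : prog) (s : seq nat) (v : nat) : Prop :=
  match e with
  | RZero => v = 0%N
  | RSucc => v = (head 0%N s).+1
  | RProj i => v = nth 0%N s i
  | RComp f gs =>
      exists2 ws, List.Forall2 (fun G w => G s w) (map run gs) ws & run f ws v
  | RPrec f g => prec_graph (run f) (run g) (behead s) (head 0%N s) v
  | RMin f =>
      run f (v :: s) 0%N /\
      forall u, (u < v)%N -> exists w, run f (u :: s) w.+1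
  end.

(* Injective; its values are positive. *)
Definition npair (a b : nat) : nat := (2 ^ a * b.*2.+1)%N.

Fixpoint godel (e : prog) : nat :=
  match e with
  | RZero => npair 0 0
  | RSucc => npair 1 0
  | RProj i => npair 2 i
  | RComp f gs => npair 3 (npair (godel f) (foldr npair 0%N (map godel gs)))
  | RPrec f g => npair 4 (npair (godel f) (godel g))
  | RMin f => npair 5 (godel f)
  end.

Notation word n := (n.-tuple bool).

(* The number with binary expansion 1s. *)
Definition bcode (s : seq bool) : nat := foldl (fun (a : nat) (b : bool) => (a.*2 + b)%N) 1%N s.

Definition word_args (n : nat) (x : word n) : seq nat := [:: bcode x].
Definition pair_args (n : nat) (z : word n * word n) : seq nat :=
  [:: bcode z.1; bcode z.2].

Section Semimeasures.
Variable R : realType.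

(* Length conditional functions are families indexed by n; an algorithm for
   such a function receives n as an argument. *)

Definition computable (T : nat -> Type) (enc : forall n, T n -> seq nat)
    (f : forall n, T n -> nat -> nat) : Prop :=
  exists e, forall n (t : T n) k, run e [:: n, k & enc n t] (f n t k).

Definition computable_rat (T : nat -> Type) (enc : forall n, T n -> seq nat)
    (q : forall n, T n -> nat -> rat) : Prop :=
  exists a b d : forall n, T n -> nat -> nat,
    [/\ computable enc a, computable enc b, computable enc d &
        forall n (t : T n) k,
          q n t k = ((a n t k)%:R - (b n t k)%:R) / (d n t k).+1%:R].

Definition enumerable (T : nat -> Type) (enc : forall n, T n -> seq nat)
    (f : forall n, T n -> R) : Prop :=
  exists q : forall n, T n -> nat -> rat,
    [/\ computable_rat enc q,
        forall n (t : T n) k, q n t k <= q n t k.+1 &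
        forall n (t : T n), (ratr (q n t k) : R) @[k --> \oo] --> f n t].

Definition universal (T : nat -> Type) (S : set (forall n, T n -> R))
    (m : forall n, T n -> R) : Prop :=
  S m /\
  forall P, S P -> exists c : R, forall n (t : T n), P n t <= c * m n t.

Definition semimeasure (P : forall n, word n -> R) : Prop :=
  (forall n (x : word n), 0 <= P n x) /\
  forall n, \sum_(x : word n) P n x <= 1.

(* A conditional semimeasure P(x|y) is represented by (x, y) |-> P(x|y). *)
Definition cond_semimeasure (P : forall n, word n * word n -> R) : Prop :=
  (forall n (z : word n * word n), 0 <= P n z) /\
  forall n (y : word n), \sum_(x : word n) P n (x, y) <= 1.

(* P(x^i|y): the strings x^i v with v of length n - i are the z of length n
   with z^i = x^i. *)
Definition cond_prefix (P : forall n, word n * word n -> R) (n i : nat)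
    (x y : word n) : R :=
  \sum_(z : word n | take i z == take i x) P n (z, y).

Definition causal (P : forall n, word n * word n -> R) : Prop :=
  forall n i (x y y' : word n), (1 <= i <= n)%N ->
    take i.-1 y = take i.-1 y' -> cond_prefix P i x y = cond_prefix P i x y'.

Definition enum_semimeasures : set (forall n, word n -> R) :=
  [set P | semimeasure P /\ enumerable word_args P].

Definition enum_causal_semimeasures : set (forall n, word n * word n -> R) :=
  [set P | [/\ cond_semimeasure P, causal P & enumerable pair_args P]].

Definition log2 (r : R) : R := ln r / ln 2.

(* [EIT m mc x y] is EIT(x <- y), where m and mc are m(.) and m(.|.^). *)
Definition EIT (m : forall n, word n -> R) (mc : forall n, word n * word n -> R)
    (n : nat) (x y : word n) : R :=
  log2 (mc n (x, y) / m n x).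

Definition eq_upto (c a b : R) : Prop := `|a - b| <= c.

End Semimeasures.

(* A machine is a program run on a binary string and the length n. *)
Definition machine (V : prog) (p : seq bool) (n v : nat) : Prop :=
  run V [:: bcode p; n] v.

Definition prefix_free (V : prog) : Prop :=
  forall n p q v w, machine V p n v -> machine V q n w -> prefix p q -> p = q.

Definition optimal (U : prog) : Prop :=
  prefix_free U /\
  forall V, prefix_free V ->
    exists c : nat, forall n p v, machine V p n v ->
      exists2 q, machine U q n v & (size q <= size p + c)%N.

(* Defaults to 0 on the empty set; for optimal U the sets used below are
   nonempty (those in [KP], as soon as the distribution is computable). *)
Definition min_length (A : set (seq bool)) : nat :=
  xget 0%N [set l | (exists2 p, A p & size p = l) /\
                    forall p, A p -> (l <= size p)%N].

Definition K2 (U : prog) (n : nat) (x y : word n) : nat :=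
  min_length [set p | machine U p n (npair (bcode x) (bcode y))].

Section Statistics.
Variable R : realType.

Definition computes_dist (e : prog) (n : nat) (P : word n * word n -> R)
    : Prop :=
  forall (x y : word n) k,
    exists2 a, run e [:: n, k & pair_args (x, y)] a &
               `|P (x, y) - a%:R / 2 ^+ k| <= 2 ^- k.

Definition computable_dist (n : nat) (P : word n * word n -> R) : Prop :=
  [/\ forall z, 0 <= P z,
      \sum_(z : word n * word n) P z = 1 &
      exists e, computes_dist e P].

(* A description of the real-valued function P is the index of an algorithm
   computing P to any precision. *)
Definition KP (U : prog) (n : nat) (P : word n * word n -> R) : nat :=
  min_length [set p | exists2 e, machine U p n (godel e) & computes_dist e P].

(* Positivity of P (x, y) is needed because [ln 0 = 0] here: a P with
   P (x, y) = 0 has -log P (x, y) = +oo and is not sufficient. *)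
Definition sufficient (U : prog) (c : R) (n : nat) (x y : word n)
    (P : word n * word n -> R) : Prop :=
  [/\ computable_dist P, 0 < P (x, y) &
      eq_upto c ((KP U P)%:R - log2 (P (x, y))) (K2 U x y)%:R].

(* The notion of sufficiency depends on the constant hidden in its =^+, so the
   constant [e d] in the comparison of P with another sufficient statistic Q is
   allowed to depend on the constant [d] for which Q is sufficient. *)
Definition minimal_sufficient (U : prog) (c : R) (e : R -> R) (n : nat)
    (x y : word n) (P : word n * word n -> R) : Prop :=
  sufficient U c x y P /\
  forall d (Q : word n * word n -> R), sufficient U d x y Q ->
    (KP U P)%:R <= (KP U Q)%:R + e d.

End Statistics.

(* Main.v *)
(* Write x = u 0^l and y = 0^l u with l ~ log n and u typical of length k = n - l.
   Given the past of x, each bit of y is determined, so m(y|x^) is bounded below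
   while m(y) ~ 2^-k.  In the other direction x runs ahead of y: causality makes
   the numbers m(x|y^), summed over all u, at most 1, so that for typical u
   m(x|y^) is no larger than m(x) ~ 2^-k.  The second pair is (y, x), and the
   equal mixture of the two uniform distributions on the pairs (u 0^l, 0^l u)
   and (0^l u, u 0^l) is a computable distribution with K(P) = O(1), hence
   minimal as soon as it is sufficient. *)
Require Import Defs.
From mathcomp Require Import all_boot all_order all_algebra.
From mathcomp Require Import all_classical all_reals all_analysis.
From mathcomp Require Import zify ring lra.

Set Implicit Arguments.
Unset Strict Implicit.
Unset Printing Implicit Defensive.

Import Order.TTheory GRing.Theory Num.Theory.
Import numFieldNormedType.Exports.

Local Open Scope classical_set_scope.
Local Open Scope ring_scope.

(** * Recursive functions *)

Fixpoint all_prop (T : Type) (Q : T -> Prop) (s : seq T) : Prop :=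
  if s is x :: s' then Q x /\ all_prop Q s' else True.

(** Needed because [prog] is nested through [seq]: the generated principle has no hypothesis for the
    programs listed in an [RComp]. *)
Lemma prog_nested_ind (Q : prog -> Prop) :
  Q RZero -> Q RSucc -> (forall i, Q (RProj i)) ->
  (forall f gs, Q f -> all_prop Q gs -> Q (RComp f gs)) ->
  (forall f g, Q f -> Q g -> Q (RPrec f g)) ->
  (forall f, Q f -> Q (RMin f)) -> forall e, Q e.
Proof.
move=> Qz Qs Qp Qc Qr Qm; fix IH 1; case=> [||i|f gs|f g|f].
- exact: Qz.
- exact: Qs.
- exact: Qp.
- apply: Qc; first exact: IH.
  by elim: gs => [|g gs IHgs]; split; first exact: IH.
- by apply: Qr; exact: IH.
- by apply: Qm; exact: IH.
Qed.

Lemma run_inj e s v w : run e s v -> run e s w -> v = w.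
Proof.
elim/prog_nested_ind: e s v w => [||i|f gs IHf IHgs|f g IHf IHg|f IHf] s v w /=.
- by move=> -> ->.
- by move=> -> ->.
- by move=> -> ->.
- case=> vs rvs rv [ws rws rw].
  suff E : vs = ws by subst ws; apply: IHf rv rw.
  elim: gs IHgs vs ws rvs rws {rv rw} => [|g gs IH] /=.
    by move=> _ vs ws rvs rws; inversion rvs; inversion rws.
  case=> IHg /IH{}IH vs ws rvs rws.
  inversion rvs as [|? a ? vs' ga gvs]; inversion rws as [|? b ? ws' gb gws].
  by rewrite (IHg _ _ _ ga gb) (IH _ _ gvs gws).
- elim: (head 0%N s) v w => [|j IH] v w /=; first exact: IHf.
  by case=> r hr hv [r' hr' hw]; rewrite (IH _ _ hr hr') in hv; apply: IHg hv hw.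
- case=> fv minv [fw minw].
  (* If the outputs differed, minimality of the larger would give the search a nonzero value at the
     smaller, where it is zero. *)
  case: (ltngtP v w) => // [/minw|/minv] [r].
    by move/(IHf _ _ _ fv).
  by move/(IHf _ _ _ fw).
Qed.

(** Total functions of whole argument lists, so that composition needs no bookkeeping of arities. *)
Definition recursive (f : seq nat -> nat) : Prop :=
  exists e, forall s, run e s (f s).

Definition recursive1 (f : nat -> nat) : Prop :=
  recursive (fun s => f (nth 0%N s 0)).

Definition recursive2 (f : nat -> nat -> nat) : Prop :=
  recursive (fun s => f (nth 0%N s 0) (nth 0%N s 1)).

Lemma recursive_eq f g : f =1 g -> recursive f -> recursive g.
Proof. by move=> fg [e he]; exists e => s; rewrite -fg. Qed.

Lemma recursive_nth i : recursive (fun s => nth 0%N s i).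
Proof. by exists (RProj i). Qed.

Lemma recursive_comp1 f g : recursive f -> recursive g ->
  recursive (fun s => f [:: g s]).
Proof.
case=> e he [a ha]; exists (RComp e [:: a]) => s /=.
by exists [:: g s] => //; do !constructor.
Qed.

Lemma recursive_comp2 f g h : recursive f -> recursive g -> recursive h ->
  recursive (fun s => f [:: g s; h s]).
Proof.
case=> e he [a ha] [b hb]; exists (RComp e [:: a; b]) => s /=.
by exists [:: g s; h s] => //; do !constructor.
Qed.

Lemma recursive_app1 F g : recursive1 F -> recursive g ->
  recursive (fun s => F (g s)).
Proof. by move=> hF hg; apply: (recursive_comp1 hF hg). Qed.

Lemma recursive_app2 F g h : recursive2 F -> recursive g -> recursive h ->
  recursive (fun s => F (g s) (h s)).
Proof. by move=> hF hg hh; apply: (recursive_comp2 hF hg hh). Qed.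

Lemma recursive_succ : recursive1 succn.
Proof. by exists RSucc => s; rewrite /= nth0. Qed.

Lemma recursive_const c : recursive (fun=> c).
Proof.
elim: c => [|c IH]; first by exists RZero.
exact: (recursive_app1 recursive_succ IH).
Qed.

Lemma recursive_prec f g : recursive f -> recursive g ->
  recursive (fun s => nat_rect (fun=> nat) (f (behead s))
                       (fun j r => g [:: j, r & behead s]) (head 0%N s)).
Proof.
case=> a ha [b hb]; exists (RPrec a b) => s /=.
by elim: (head 0%N s) => [|j IH] //=; eexists; eauto.
Qed.

Lemma recursive_min f v : recursive f -> (forall s, f (v s :: s) = 0%N) ->
  (forall s u, (u < v s)%N -> f (u :: s) != 0%N) -> recursive v.
Proof.
case=> e he v0 vmin; exists (RMin e) => s /=; split; first by rewrite -(v0 s).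
by move=> u /vmin; rewrite -lt0n => fu; exists (f (u :: s)).-1; rewrite prednK.
Qed.

Lemma recursive_add : recursive2 addn.
Proof.
have h := recursive_prec (recursive_nth 0)
  (recursive_app1 recursive_succ (recursive_nth 1)).
apply: recursive_eq h => s /=; rewrite -nth0; case: s => [|a s] //=.
by elim: a => //= a ->; rewrite addSn.
Qed.

Lemma recursive_mul : recursive2 muln.
Proof.
have h := recursive_prec (recursive_const 0)
  (recursive_app2 recursive_add (recursive_nth 2) (recursive_nth 1)).
apply: recursive_eq h => s /=; rewrite -nth0; case: s => [|a s] //=.
by elim: a => //= a ->; rewrite mulSn.
Qed.

Lemma recursive_exp2 : recursive1 (expn 2).
Proof.
have h := recursive_prec (recursive_const 1)
  (recursive_app2 recursive_add (recursive_nth 1) (recursive_nth 1)).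
apply: recursive_eq h => s /=; rewrite -nth0; case: s => [|a s] //=.
by elim: a => //= a ->; rewrite expnS mul2n addnn.
Qed.

Lemma recursive_pred : recursive1 predn.
Proof.
have h := recursive_prec (recursive_const 0) (recursive_nth 0).
by apply: recursive_eq h => s /=; rewrite -nth0; case: (nth _ _ _).
Qed.

Lemma recursive_sub : recursive2 subn.
Proof.
have h := recursive_prec (recursive_nth 0)
  (recursive_app1 recursive_pred (recursive_nth 1)).
apply: recursive_eq (recursive_comp2 h (recursive_nth 1) (recursive_nth 0)) => s /=.
by elim: (nth 0%N s 1) => [|a IH] /=; [rewrite subn0 | rewrite IH subnS].
Qed.

Lemma recursive_leq f g : recursive f -> recursive g ->
  recursive (fun s => (f s <= g s)%N).
Proof.
move=> hf hg.
have h := recursive_app2 recursive_sub (recursive_const 1)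
  (recursive_app2 recursive_sub hf hg).
by apply: recursive_eq h => s; rewrite /leq; case: (f s - g s)%N => [|[]].
Qed.

Lemma recursive_eqn f g : recursive f -> recursive g ->
  recursive (fun s => f s == g s).
Proof.
move=> hf hg.
have h := recursive_app2 recursive_mul (recursive_leq hf hg) (recursive_leq hg hf).
by apply: recursive_eq h => s; rewrite eqn_leq mulnb.
Qed.

(** The quotient is the least q with a < (q + 1) 2^j, found by unbounded search. *)
Lemma recursive_div2 : recursive2 (fun a j => a %/ 2 ^ j)%N.
Proof.
pose f s := ((nth 0 s 0).+1 * 2 ^ nth 0 s 2 <= nth 0 s 1)%N.
have hf : recursive f.
  apply: recursive_leq (recursive_nth 1); apply: (recursive_app2 recursive_mul).
    exact: (recursive_app1 recursive_succ (recursive_nth 0)).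
  exact: (recursive_app1 recursive_exp2 (recursive_nth 2)).
apply: (recursive_min hf) => [s|s u]; rewrite /f /=.
  by rewrite leqNgt ltn_ceil ?expn_gt0.
by rewrite -leq_divRL ?expn_gt0 // => ->.
Qed.

(** The number l of padding zeros. Taking [n.+1] makes it positive as soon as n is, so that the lag
    is a genuine delay. *)
Definition blank n := up_log 2 n.+1.

Lemma recursive_blank : recursive1 blank.
Proof.
pose f s := (2 ^ nth 0 s 0 <= nth 0 s 1)%N.
have hf : recursive f.
  apply: recursive_leq (recursive_nth 1).
  exact: (recursive_app1 recursive_exp2 (recursive_nth 0)).
apply: (recursive_min hf) => [s|s u]; rewrite /f /blank /=.
  by rewrite leqNgt up_logP.
case: (leqP (2 ^ u) (nth 0 s 0)) => // /(up_log_min (isT : 1 < 2)%N).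
by rewrite leqNgt => /negP.
Qed.

Lemma recursive_npair : recursive2 npair.
Proof.
apply: (recursive_app2 recursive_mul).
  exact: (recursive_app1 recursive_exp2 (recursive_nth 0)).
apply: (recursive_app1 recursive_succ).
have h := recursive_app2 recursive_add (recursive_nth 1) (recursive_nth 1).
by apply: recursive_eq h => s; rewrite addnn.
Qed.

(** Builds a machine with a decidable domain: h = 0 says where it halts, and f says what it
    outputs. *)
Lemma guarded_machine h f : recursive2 h -> recursive2 f ->
  exists V, forall p n v,
    machine V p n v <-> h (bcode p) n = 0%N /\ v = f (bcode p) n.
Proof.
move=> hh hf.
(* Minimisation looks for a zero of h + [v <> f]: there is none when h > 0, and exactly one, v = f,
   when h = 0. *)
pose t s := (h (nth 0 s 1) (nth 0 s 2) +
  (1 - (nth 0 s 0 == f (nth 0 s 1) (nth 0 s 2))))%N.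
have [e he] : recursive t.
  apply: (recursive_app2 recursive_add).
    exact: (recursive_app2 hh (recursive_nth 1) (recursive_nth 2)).
  apply: (recursive_app2 recursive_sub (recursive_const 1)).
  apply: recursive_eqn (recursive_nth 0) _.
  exact: (recursive_app2 hf (recursive_nth 1) (recursive_nth 2)).
exists (RMin e) => p n v; split=> [[h0 _]|[h0 ->]].
  have /esym/eqP := run_inj h0 (he _).
  by rewrite /t /= addn_eq0 => /andP[/eqP-> ]; case: (v =P _).
split; first by have := he [:: f (bcode p) n; bcode p; n]; rewrite /t /= h0 eqxx.
move=> u /ltn_eqF uf; have := he [:: u; bcode p; n].
by rewrite /t /= h0 uf; exists 0%N.
Qed.

(** * Words and their codes *)

Definition bval (s : seq bool) : nat :=
  foldl (fun (a : nat) (b : bool) => (a.*2 + b)%N) 0%N s.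

Lemma foldl_bval a s :
  foldl (fun (a : nat) (b : bool) => (a.*2 + b)%N) a s
  = (a * 2 ^ size s + bval s)%N.
Proof.
elim/last_ind: s a => [|s b IH] a; first by rewrite /= muln1 addn0.
rewrite /bval !foldl_rcons IH -/(bval s) size_rcons expnS; lia.
Qed.

Lemma bcodeE s : bcode s = (2 ^ size s + bval s)%N.
Proof. by rewrite /bcode foldl_bval mul1n. Qed.

Lemma bval_cat s t : bval (s ++ t) = (bval s * 2 ^ size t + bval t)%N.
Proof. by rewrite {1}/bval foldl_cat foldl_bval. Qed.

Lemma bval_lt s : (bval s < 2 ^ size s)%N.
Proof.
elim/last_ind: s => // s b; rewrite /bval foldl_rcons -/(bval s) size_rcons expnS.
by case: b; lia.
Qed.

Lemma bval_nseq0 l : bval (nseq l false) = 0%N.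
Proof. by elim: l. Qed.

Lemma bcode_rcons s b : bcode (rcons s b) = ((bcode s).*2 + b)%N.
Proof. by rewrite /bcode foldl_rcons. Qed.

Lemma bcode_gt0 s : (0 < bcode s)%N.
Proof. by rewrite bcodeE addn_gt0 expn_gt0. Qed.

Lemma bcode_inj : injective bcode.
Proof.
elim/last_ind=> [|s b IH] t; case/lastP: t => [|t c] //;
  rewrite ?bcode_rcons ?(erefl : bcode [::] = 1%N) => E.
- by have := bcode_gt0 t; case: c E; lia.
- by have := bcode_gt0 s; case: b E; lia.
- have [Est Ebc] : bcode s = bcode t /\ b = c.
    by case: b c E => [] [] E; split=> //; lia.
  by rewrite (IH _ Est) Ebc.
Qed.

Lemma bval0 s : bval s = 0%N -> s = nseq (size s) false.
Proof.
by move=> s0; apply: bcode_inj; rewrite !bcodeE s0 size_nseq bval_nseq0.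
Qed.

Definition mkword n (s : seq bool) : word n := insubd (nseq_tuple n false) s.

Lemma val_mkword n s : size s = n -> mkword n s = s :> seq bool.
Proof. by move=> sn; rewrite val_insubd sn eqxx. Qed.

Lemma blank_le n : (blank n <= n)%N.
Proof. by apply: up_log_min => //; apply: ltn_expl. Qed.

Definition free_len n := (n - blank n)%N.

Lemma blank_free n : (blank n + free_len n)%N = n.
Proof. by rewrite subnKC // blank_le. Qed.

Lemma exp_len n : (2 ^ n = 2 ^ free_len n * 2 ^ blank n)%N.
Proof. by rewrite -expnD addnC blank_free. Qed.

Definition lead n (u : word (free_len n)) : word n :=
  mkword n (u ++ nseq (blank n) false).

Definition lag n (u : word (free_len n)) : word n :=
  mkword n (nseq (blank n) false ++ u).

(** Extends the map from u 0^l to 0^l u to all words, as a deterministic causal rule requires. *)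
Definition delay n (x : word n) : word n :=
  mkword n (nseq (blank n) false ++ take (free_len n) x).

Lemma val_lead n (u : word (free_len n)) :
  lead u = u ++ nseq (blank n) false :> seq bool.
Proof.
by rewrite val_mkword // size_cat size_tuple size_nseq addnC blank_free.
Qed.

Lemma val_lag n (u : word (free_len n)) :
  lag u = nseq (blank n) false ++ u :> seq bool.
Proof. by rewrite val_mkword // size_cat size_tuple size_nseq blank_free. Qed.

Lemma val_delay n (x : word n) :
  delay x = nseq (blank n) false ++ take (free_len n) x :> seq bool.
Proof.
rewrite val_mkword // size_cat size_nseq size_takel ?blank_free //.
by rewrite size_tuple leq_subr.
Qed.

Lemma delay_lead n (u : word (free_len n)) : delay (lead u) = lag u.
Proof.
by apply: val_inj; rewrite /= val_delay val_lag val_lead take_size_cat ?size_tuple.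
Qed.

Lemma lead_inj n : injective (@lead n).
Proof.
move=> u v /(congr1 (fun x => take (free_len n) (tval x))).
by rewrite !val_lead !take_size_cat ?size_tuple // => /val_inj.
Qed.

Lemma lag_inj n : injective (@lag n).
Proof.
move=> u v /(congr1 (fun x => drop (blank n) (tval x))).
by rewrite !val_lag !drop_size_cat ?size_nseq // => /val_inj.
Qed.

Lemma bcode_lead n (u : word (free_len n)) :
  bcode (lead u) = (bcode u * 2 ^ blank n)%N.
Proof.
rewrite val_lead !bcodeE bval_cat size_cat size_nseq bval_nseq0 expnD.
by rewrite mulnDl addn0.
Qed.

(** Putting zeros in front of u only moves the marker digit 1 from weight 2^k to weight 2^n. *)
Lemma bcode_lag n (u : word (free_len n)) :
  bcode (lag u) = (2 ^ n + bcode u - 2 ^ free_len n)%N.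
Proof.
rewrite val_lag !bcodeE bval_cat size_cat size_nseq bval_nseq0 size_tuple.
rewrite blank_free; lia.
Qed.

(** Arithmetic forms, on codes, of membership in the ranges of [lead] and [lag] and of the graph of
    [delay]; they make these predicates recursive. The last one is written additively to avoid
    truncated subtraction. *)
Definition test_lead n a : bool :=
  (a %/ 2 ^ blank n * 2 ^ blank n == a)%N.
Definition test_lag n a : bool := (a < 2 ^ n + 2 ^ free_len n)%N.
Definition test_delay n a b : bool :=
  (b + 2 ^ free_len n == 2 ^ n + a %/ 2 ^ blank n)%N.

Lemma bcode_split n (x : word n) j : (j <= n)%N ->
  bcode x = (2 ^ n + bval (take j x) * 2 ^ (n - j) + bval (drop j x))%N.
Proof.
by move=> jn; rewrite bcodeE -{2}(cat_take_drop j x) bval_cat size_drop size_tuple addnA.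
Qed.

Lemma free_lenK n : (n - free_len n)%N = blank n.
Proof. by rewrite subKn // blank_le. Qed.

Lemma test_leadP n (x : word n) :
  (x \in codom (@lead n)) = test_lead n (bcode x).
Proof.
apply/codomP/idP => [[u ->]|].
  by rewrite /test_lead bcode_lead mulnK ?expn_gt0.
have kn : (free_len n <= n)%N by rewrite leq_subr.
have sz : size (take (free_len n) x) == free_len n.
  by rewrite size_takel // size_tuple.
have szd : size (drop (free_len n) x) = blank n.
  by rewrite size_drop size_tuple free_lenK.
rewrite /test_lead (bcode_split x kn) free_lenK => /eqP E.
(* The last l bits have value below 2^l, so they are the remainder that the test forces to
   vanish. *)
have b0 : bval (drop (free_len n) x) = 0%N.
  have := bval_lt (drop (free_len n) x); rewrite szd => lt.
  move: E; rewrite exp_len -mulnDl divnMDl ?expn_gt0 // divn_small //.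
  by rewrite addn0; lia.
exists (Tuple sz); apply: val_inj; rewrite /= val_lead /=.
rewrite -[LHS](cat_take_drop (free_len n)); congr (_ ++ _).
by rewrite [LHS](bval0 b0) szd.
Qed.

Lemma test_lagP n (y : word n) :
  (y \in codom (@lag n)) = test_lag n (bcode y).
Proof.
have ln := blank_le n.
apply/codomP/idP => [[u ->]|].
  rewrite /test_lag bcode_lag bcodeE size_tuple addnCA addKn ltn_add2l.
  by have := bval_lt u; rewrite size_tuple.
have sz : size (drop (blank n) y) == free_len n.
  by rewrite size_drop size_tuple.
have szt : size (take (blank n) y) = blank n by rewrite size_takel // size_tuple.
rewrite /test_lag (bcode_split y ln) -/(free_len n) => lt.
have b0 : bval (take (blank n) y) = 0%N.
  move: lt; rewrite -addnA ltn_add2l => lt.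
  by case: (bval _) lt => // a; rewrite mulSn; lia.
exists (Tuple sz); apply: val_inj; rewrite /= val_lag /=.
rewrite -[LHS](cat_take_drop (blank n)); congr (_ ++ _).
by rewrite [LHS](bval0 b0) szt.
Qed.

Lemma test_delayP n (x y : word n) :
  (y == delay x) = test_delay n (bcode x) (bcode y).
Proof.
have kn : (free_len n <= n)%N by rewrite leq_subr.
have sz : size (take (free_len n) x) = free_len n.
  by rewrite size_takel // size_tuple.
have szd : size (drop (free_len n) x) = blank n.
  by rewrite size_drop size_tuple free_lenK.
rewrite -(inj_eq val_inj) -(inj_eq bcode_inj) /= val_delay /test_delay.
rewrite (bcode_split x kn) free_lenK.
rewrite [bcode (_ ++ _)]bcodeE bval_cat size_cat size_nseq bval_nseq0 sz blank_free.
have := bval_lt (drop (free_len n) x); rewrite szd => lt.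
rewrite {3}exp_len -mulnDl divnMDl ?expn_gt0 // divn_small //.
rewrite addn0 mul0n add0n addnA -[in RHS]addnA.
by rewrite [(2 ^ free_len n + _)%N]addnC addnA eqn_add2r.
Qed.

Lemma sum_eq_inj (T S : finType) (f : T -> S) (z : S) : injective f ->
  (\sum_t (z == f t))%N = (z \in codom f).
Proof.
move=> finj; case: (boolP (z \in codom f)) => [/codomP[t ->]|zf].
  rewrite (bigD1 t) //= eqxx big1 ?addn0 // => s st.
  by rewrite (inj_eq finj) eq_sym (negbTE st).
by rewrite big1 // => t _; case: eqP zf => // ->; rewrite codom_f.
Qed.

Lemma codom_lead_lag n (x y : word n) :
  ((x, y) \in codom (fun u : word (free_len n) => (lead u, lag u)))
  = test_lead n (bcode x) && test_delay n (bcode x) (bcode y).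
Proof.
rewrite -test_leadP -test_delayP; apply/codomP/andP => [[u [-> ->]]|[]].
  by rewrite codom_f delay_lead.
by move=> /codomP[u ->] /eqP ->; exists u; rewrite delay_lead.
Qed.

(** * Complexity bounds *)

(** By well-ordering a nonempty set has a shortest element, so the default value of [min_length] is
    not reached. *)
Lemma min_lengthP (A : set (seq bool)) p : A p ->
  (exists2 q, A q & size q = min_length A) /\
  (forall q, A q -> (min_length A <= size q)%N).
Proof.
move=> Ap; rewrite /min_length.
pose S l := `[< exists2 q, A q & size q = l >].
have exS : exists l, S l by exists (size p); apply/asboolP; exists p.
case: (ex_minnP exS) => l /asboolP Sl lmin.
apply: (@xgetPex _ 0%N [set l | (exists2 p, A p & size p = l) /\
                    forall p, A p -> (l <= size p)%N]).
exists l; split=> // q Aq; apply: lmin; apply/asboolP; by exists q.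
Qed.

Lemma bcode_lt s : (bcode s < 2 ^ (size s).+1)%N.
Proof. by rewrite bcodeE expnS; have := bval_lt s; lia. Qed.

(** Since machines are deterministic, distinct outputs have distinct shortest programs, and strings
    shorter than j have codes below 2^j. *)
Lemma card_short (T : finType) (U : prog) n (code : T -> nat) j :
  injective code -> (forall t, exists p, machine U p n (code t)) ->
  (#|[pred t | min_length [set p | machine U p n (code t)] < j]| <= 2 ^ j)%N.
Proof.
move=> cinj hp.
pose A t := [set p | machine U p n (code t)].
have hq t : exists q, A t q /\ size q = min_length (A t).
  by have [p /(@min_lengthP (A t))[[q Aq sq] _]] := hp t; exists q.
have [q hqP] := choice hq.
have qb t : (min_length (A t) < j)%N -> (bcode (q t) < 2 ^ j)%N.
  move=> lt; apply: leq_trans (bcode_lt _) _.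
  by rewrite leq_exp2l // (hqP t).2.
pose f t : 'I_(2 ^ j) := insubd (Ordinal (expn_gt0 2 j : (0 < 2 ^ j)%N)) (bcode (q t)).
rewrite -[leqRHS]card_ord -(@card_in_imset _ _ f); first exact: max_card.
move=> t s; rewrite !inE => /qb ht /qb hs /(congr1 val); rewrite !val_insubd ht hs.
move=> /bcode_inj qts; apply: cinj.
have [h1 _] := hqP t; have [h2 _] := hqP s; move: h1; rewrite /A qts => h1.
exact: run_inj h1 h2.
Qed.

Lemma const_complexity U : optimal U ->
  forall g, exists c, forall n, exists2 q, machine U q n g & (size q <= c)%N.
Proof.
case=> _ hU g.
(* The code is 1 for the empty string only, so this machine halts on the empty program alone and is
   trivially prefix-free. *)
have hh : recursive2 (fun b n => b - 1)%N.
  exact: (recursive_app2 recursive_sub (recursive_nth 0) (recursive_const 1)).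
have [V hV] := guarded_machine hh (recursive_const g).
have nil p n v : machine V p n v -> p = [::].
  move=> /hV[h _]; apply/nilP; rewrite /nilp; move: h; rewrite bcodeE.
  by have := ltn_expl (size p) (isT : (1 < 2)%N); lia.
have [|c hc] := hU V; first by move=> n p q v w /nil -> /nil ->.
exists c => n; have [|q hq sq] := hc n [::] g; first exact/hV.
by exists q.
Qed.

(** The word u serves as its own program. As n is given to the machine, all programs can be required
    to have length exactly k, which makes the domain prefix-free at no cost. *)
Lemma free_complexity U F : optimal U -> recursive2 F ->
  exists c, forall n (u : word (free_len n)),
    exists2 q, machine U q n (F (bcode u) n) & (size q <= free_len n + c)%N.
Proof.
case=> _ hU hF.
(* Vanishes exactly when the leading 1 of the code has weight 2^k, that is, when the program has
   length k. *)
pose h b n : nat := (1 - (b %/ 2 ^ (free_len n) == 1))%N.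
have hh : recursive2 h.
  apply: (recursive_app2 recursive_sub (recursive_const 1)).
  apply: recursive_eqn (recursive_const 1).
  apply: (recursive_app2 recursive_div2 (recursive_nth 0)).
  apply: (recursive_app2 recursive_sub (recursive_nth 1)).
  exact: (recursive_app1 recursive_blank (recursive_nth 1)).
have h0 p n : h (bcode p) n = 0%N <-> size p = free_len n.
  rewrite /h; split; last first.
    move=> <-; rewrite bcodeE divnDl ?dvdnn // divnn expn_gt0 divn_small ?bval_lt //.
  have [E _|//] := eqVneq.
  have lo := leq_trunc_div (bcode p) (2 ^ free_len n).
  have hi := ltn_ceil (bcode p) (expn_gt0 2 (free_len n) : (0 < _)%N).
  move: lo hi; rewrite E mul1n -expnS => lo hi.
  have lo' : (2 ^ size p <= bcode p)%N by rewrite bcodeE leq_addr.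
  have := leq_ltn_trans lo (bcode_lt p); have := leq_ltn_trans lo' hi.
  by rewrite !ltn_exp2l // !ltnS => sk ks; apply/eqP; rewrite eqn_leq sk ks.
have [V hV] := guarded_machine hh hF.
have [|c hc] := hU V.
  move=> n p q v w /hV[/h0 sp _] /hV[/h0 sq _] /prefixP[r E].
  move: sq; rewrite E size_cat sp => /eqP.
  by rewrite -{2}[free_len n]addn0 eqn_add2l => /nilP ->; rewrite cats0.
exists c => n u; have [|q hq sq] := hc n u (F (bcode u) n).
  by apply/hV; split=> //; apply/h0; rewrite size_tuple.
by exists q => //; rewrite -[free_len n](size_tuple u).
Qed.

(** * Universal semimeasures *)

Lemma recursive_andb (f g : seq nat -> bool) :
  recursive f -> recursive g -> recursive (fun s => f s && g s).
Proof.
move=> hf hg; apply: recursive_eq (recursive_app2 recursive_mul hf hg) => s.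
by rewrite mulnb.
Qed.

Lemma recursive_free_len f : recursive f -> recursive (fun s => free_len (f s)).
Proof.
move=> hf; apply: (recursive_app2 recursive_sub hf).
exact: (recursive_app1 recursive_blank hf).
Qed.

Lemma recursive_exp f : recursive f -> recursive (fun s => 2 ^ f s)%N.
Proof. exact: recursive_app1 recursive_exp2. Qed.

Lemma recursive_test_lead : recursive2 test_lead.
Proof.
have hl := recursive_app1 recursive_blank (recursive_nth 0).
apply: recursive_eqn (recursive_nth 1).
apply: (recursive_app2 recursive_mul) (recursive_exp hl).
exact: (recursive_app2 recursive_div2 (recursive_nth 1) hl).
Qed.

Lemma recursive_test_lag : recursive2 test_lag.
Proof.
apply: (recursive_leq (recursive_app1 recursive_succ (recursive_nth 1))).
apply: (recursive_app2 recursive_add); apply: recursive_exp.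
  exact: recursive_nth.
exact: recursive_free_len (recursive_nth 0).
Qed.

Lemma recursive_test_delay (f g h : seq nat -> nat) :
  recursive f -> recursive g -> recursive h ->
  recursive (fun s => test_delay (f s) (g s) (h s)).
Proof.
move=> hf hg hh; apply: recursive_eqn; apply: (recursive_app2 recursive_add).
- by [].
- exact: recursive_exp (recursive_free_len hf).
- exact: recursive_exp.
- exact: (recursive_app2 recursive_div2 hg (recursive_app1 recursive_blank hf)).
Qed.

Lemma recursive_computable (T : nat -> Type) (enc : forall n, T n -> seq nat)
    F (f : forall n, T n -> nat -> nat) :
  recursive F -> (forall n t k, F [:: n, k & enc n t] = f n t k) ->
  computable enc f.
Proof. by case=> e he Ff; exists e => n t k; rewrite -Ff. Qed.

(** A function with exactly computable dyadic values is the limit of a constant sequence. *)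
Lemma enumerable_dyadic (R : realType) (T : nat -> Type)
    (enc : forall n, T n -> seq nat) F G (f : forall n, T n -> R) :
  recursive F -> recursive1 G ->
  (forall n t k, f n t = (F [:: n, k & enc n t])%:R / 2 ^+ G n) ->
  enumerable enc f.
Proof.
move=> hF hG fE.
pose q n (t : T n) k : rat := (F [:: n, k & enc n t])%:R / 2 ^+ G n.
have qE n t k : ratr (q n t k) = f n t :> R.
  by rewrite (fE _ _ k) fmorph_div rmorphXn /= !ratr_nat.
exists q; split=> [|n t k|n t].
- exists (fun n t k => F [:: n, k & enc n t]), (fun _ _ _ => 0%N).
  (* Denominators are represented as [d.+1], hence the predecessor. *)
  exists (fun n _ _ => (2 ^ G n).-1); split.
  + exact: recursive_computable hF _.
  + exact: recursive_computable (recursive_const 0) _.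
  + apply: (recursive_computable (F := fun s => (2 ^ G (nth 0%N s 0)).-1)) => //.
    exact: (recursive_app1 recursive_pred (recursive_exp hG)).
  + by move=> n t k; rewrite subr0 prednK ?expn_gt0 // natrX.
- by rewrite -(ler_rat R) !qE.
- rewrite (_ : (fun k => _) = fun=> f n t); first exact: cvg_cst.
  by apply/funext => k; rewrite qE.
Qed.

(** The domination constant may be raised to at least 1 since m is nonnegative; its positivity
    allows logarithms later. *)
Lemma universal_ge (R : realType) (T : nat -> Type)
    (S : set (forall n, T n -> R)) (m P : forall n, T n -> R) :
  universal S m -> (forall n t, 0 <= m n t) -> S P ->
  exists2 c : R, 0 < c & forall n t, P n t <= c * m n t.
Proof.
case=> _ hm m0 /hm[c hc]; exists (Num.max c 1); first by rewrite lt_max ltr01 orbT.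
move=> n t; apply: le_trans (hc n t) _; apply: ler_wpM2r => //.
by rewrite le_max lexx.
Qed.

Lemma sum_words (R : realType) j (c : R) : \sum_(u : word j) c = 2 ^+ j * c.
Proof. by rewrite sumr_const card_tuple card_bool -[LHS]mulr_natl natrX. Qed.

Lemma sum_codom (R : realType) j (S : finType) (f : word j -> S) : injective f ->
  \sum_(z : S) (z \in codom f)%:R = 2 ^+ j :> R.
Proof.
move=> finj; under eq_bigr => z _ do rewrite -(sum_eq_inj z finj) natr_sum.
rewrite exchange_big /= -[RHS]mulr1 -sum_words; apply: eq_bigr => u _.
by rewrite (bigD1 (f u)) //= eqxx big1 ?addr0 // => z /negbTE ->.
Qed.

(** The uniform distribution on the range of [f n] is an enumerable semimeasure with value 2^-k
    there, and m dominates it. *)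
Lemma universal_uniform (R : realType) (m : forall n, word n -> R)
    (f : forall n, word (free_len n) -> word n) (test : nat -> nat -> bool) :
  universal (@enum_semimeasures R) m -> (forall n, injective (f n)) ->
  recursive2 test ->
  (forall n (x : word n), (x \in codom (f n)) = test n (bcode x)) ->
  exists2 c : R, 0 < c &
    forall n (u : word (free_len n)), 1 <= c * (m n (f n u) * 2 ^+ free_len n).
Proof.
move=> hm finj htest testP; have [[[m0 _] _] _] := hm.
pose P n (x : word n) : R := (x \in codom (f n))%:R / 2 ^+ free_len n.
have [|c c0 hc] := universal_ge hm m0 (P := P).
  split; first split=> [n x|n].
  - by rewrite divr_ge0 ?exprn_ge0.
  - by rewrite -mulr_suml (sum_codom R (finj n)) mulfV // expf_neq0 // pnatr_eq0.
  - apply: (@enumerable_dyadic _ _ _ (fun s => test (nth 0 s 0) (nth 0 s 2))%N free_len).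
    + exact: (recursive_app2 htest (recursive_nth 0) (recursive_nth 2)).
    + exact: recursive_free_len (recursive_nth 0).
    + by move=> n x k; rewrite /P testP.
exists c => // n u; have := hc n (f n u).
by rewrite /P codom_f mulrA ler_pdivrMr ?exprn_gt0.
Qed.

(** * Causal semimeasures dominated by the universal one *)

Lemma eq_take n (s t : word n) i :
  (forall j, (j < i)%N -> nth false s j = nth false t j) ->
  take i s = take i t.
Proof.
move=> st; apply: (@eq_from_nth _ false); first by rewrite !size_take !size_tuple.
move=> j; rewrite size_take_min leq_min => /andP[ji _].
by rewrite !nth_take // st.
Qed.

Lemma nth_take_eq n (s t : word n) i j : take i s = take i t -> (j < i)%N ->
  nth false s j = nth false t j.
Proof. by move=> E ji; rewrite -(nth_take _ ji) E nth_take. Qed.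

(** Bit j of the delayed word is 0 or bit j - l of x, and l >= 1: the output at each time uses
    strictly earlier input only. *)
Lemma take_delay n (x x' : word n) i : (1 <= i <= n)%N ->
  take i.-1 x = take i.-1 x' -> take i (delay x) = take i (delay x').
Proof.
move=> /andP[i1 iN] E; apply: eq_take => j ji.
rewrite !val_delay !nth_cat size_nseq; case: ltnP => // lj.
have b0 : (0 < blank n)%N.
  by rewrite /blank; case: (up_log _ _) (up_logP n.+1 (isT : 1 < 2)%N); lia.
have [jk|kj] := ltnP (j - blank n) (free_len n).
  by rewrite !nth_take //; apply: (nth_take_eq E); lia.
by rewrite !nth_default // size_take_min geq_min kj.
Qed.

(** The deterministic rule that puts all mass on y = [delay x] given x is causal and computable, so
    [mc] dominates it. *)
Lemma universal_delay (R : realType) (mc : forall n, word n * word n -> R) :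
  universal (@enum_causal_semimeasures R) mc ->
  exists2 c : R, 0 < c & forall n (x : word n), 1 <= c * mc n (delay x, x).
Proof.
move=> hmc; have [[[m0 _] _ _] _] := hmc.
pose P n (z : word n * word n) : R := (z.1 == delay z.2)%:R.
have cpE n i (y x : word n) :
    cond_prefix P i y x = (take i (delay x) == take i y)%:R.
  rewrite /cond_prefix /P /=; have [E|E] := eqVneq.
    by rewrite (bigD1 (delay x)) ?E //= eqxx big1 ?addr0 // => z /andP[_ /negbTE ->].
  by rewrite big1 // => z /eqP Ez; case: eqP => // zE; rewrite -zE Ez eqxx in E.
have [|c c0 hc] := universal_ge hmc m0 (P := P); last first.
  by exists c => // n x; have := hc n (delay x, x); rewrite /P eqxx.
split.
- split=> [n z|n y]; first exact: ler0n.
  by rewrite (bigD1 (delay y)) //= /P /= eqxx big1 ?addr0 // => z /negbTE ->.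
- by move=> n i y x x' hi E; rewrite !cpE (take_delay hi E).
(* The arguments are n, k, the code of the output and the code of the condition, so the delayed word
   x sits in position 3. *)
- pose F s := test_delay (nth 0%N s 0) (nth 0%N s 3) (nth 0%N s 2) : nat.
  apply: (@enumerable_dyadic _ _ _ F (fun=> 0%N)).
  + by apply: recursive_test_delay; apply: recursive_nth.
  + exact: recursive_const.
  + by move=> n [y x] k; rewrite /P /F /= test_delayP expr0 divr1.
Qed.

(** The arguments are projected first because the given program might read a fourth one. *)
Lemma computable_fst f : computable word_args f ->
  computable pair_args (fun n z k => f n z.1 k).
Proof.
case=> e he; exists (RComp e [:: RProj 0; RProj 1; RProj 2]) => n [x y] k /=.
by exists [:: n; k; bcode x]; [do !constructor | exact: he n x k].
Qed.

Lemma enumerable_fst (R : realType) (f : forall n, word n -> R) :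
  enumerable word_args f -> enumerable pair_args (fun n z => f n z.1).
Proof.
case=> q [[a [b [d [ha hb hd qE]]]] qle qcvg].
exists (fun n z k => q n z.1 k); split=> [|n z k|n z]; last exact: qcvg.
- exists (fun n z => a n z.1), (fun n z => b n z.1), (fun n z => d n z.1).
  by split=> [|||n z k]; first [exact: computable_fst | exact: qE].
- exact: qle.
Qed.

(** Read as a conditional semimeasure that ignores its condition, m is causal, hence dominated by
    [mc]. *)
Lemma universal_unconditional (R : realType) (m : forall n, word n -> R)
    (mc : forall n, word n * word n -> R) :
  universal (@enum_semimeasures R) m ->
  universal (@enum_causal_semimeasures R) mc ->
  exists2 c : R, 0 < c & forall n (x y : word n), m n x <= c * mc n (x, y).
Proof.
move=> [[[m0 m1] menum] _] hmc; have [[[mc0 _] _ _] _] := hmc.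
have [|c c0 hc] := universal_ge hmc mc0 (P := fun n z => m n z.1).
  by split; [split=> [n z|n y]; [exact: m0 | exact: m1] | | exact: enumerable_fst].
by exists c => // n x y; apply: hc n (x, y).
Qed.

(** * Causal sums *)

Definition flip n i (x : word n) : word n :=
  [tuple tnth x j (+) (j == i :> nat) | j < n].

Lemma nth_flip n i (x : word n) j : (j < n)%N ->
  nth false (flip i x) j = nth false x j (+) (j == i).
Proof.
by move=> jn; rewrite -[j]/(val (Ordinal jn)) -!tnth_nth tnth_mktuple.
Qed.

Lemma flipK n i : involutive (@flip n i).
Proof.
by move=> x; apply: eq_from_tnth => j; rewrite !tnth_mktuple addbK.
Qed.

Lemma take_flip n i (x : word n) : take i (flip i x) = take i x.
Proof.
apply: eq_take => j ji; have [jn|nj] := ltnP j n.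
  by rewrite nth_flip // (ltn_eqF ji) addbF.
by rewrite !nth_default // size_tuple.
Qed.

(** The extensions of the first i bits of x are split by their next bit, which agrees either with x
    or with its flip. *)
Lemma cond_prefix_flip (R : realType) (P : forall n, word n * word n -> R)
    n i (x y : word n) : (i < n)%N ->
  cond_prefix P i.+1 x y + cond_prefix P i.+1 (flip i x) y = cond_prefix P i x y.
Proof.
move=> iN; rewrite /cond_prefix.
have takeS (w z : word n) : (take i.+1 z == take i.+1 w)
    = (take i z == take i w) && (nth false z i == nth false w i).
  by rewrite !(take_nth false) ?size_tuple // eqseq_rcons.
rewrite (eq_bigl _ _ (takeS x)) (eq_bigl _ _ (takeS (flip i x))).
rewrite [RHS](bigID (fun z : word n => nth false z i == nth false x i)).
congr (_ + _); apply: eq_bigl => z.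
rewrite take_flip nth_flip // eqxx addbT; congr (_ && _).
by case: (nth _ z i); case: (nth _ x i).
Qed.

(* Flipping bit i of x leaves the first i bits of g x unchanged, and by causality
   these alone matter for prefixes of length i + 1: so the sum over x of
   [cond_prefix P i x (g x)] halves when i increases by one. *)
Lemma causal_sum_le1 (R : realType) (P : forall n, word n * word n -> R) n
    (g : word n -> word n) :
  cond_semimeasure P -> causal P ->
  (forall i (x x' : word n), (i < n)%N -> take i x = take i x' ->
     take i (g x) = take i (g x')) ->
  \sum_(x : word n) P n (x, g x) <= 1.
Proof.
move=> [P0 P1] Pc gc.
pose A i := \sum_(x : word n) cond_prefix P i x (g x).
have step i : (i < n)%N -> A i = 2 * A i.+1.
  move=> iN; rewrite mulr_natl mulr2n {3}/A (reindex_inj (inv_inj (@flipK n i))) /=.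
  rewrite -big_split /=; apply: eq_bigr => x _.
  rewrite -(cond_prefix_flip P x (g x) iN); congr (_ + _).
  by apply: Pc => //=; apply: gc => //; rewrite take_flip.
have A0 i : (i <= n)%N -> A 0%N = 2 ^+ i * A i.
  elim: i => [|i IH] iN; first by rewrite mul1r.
  by rewrite IH 1?ltnW // step // exprSr mulrA.
have AnE : A n = \sum_(x : word n) P n (x, g x).
  apply: eq_bigr => x _; rewrite /cond_prefix (big_pred1 x) // => z.
  by rewrite !take_oversize ?size_tuple.
(* Now 2^n [A n] = [A 0], a sum of 2^n total masses, each at most 1. *)
rewrite -AnE -(ler_pM2l (exprn_gt0 n (ltr0n R 2))) -A0 //.
rewrite -sum_words.
apply: ler_sum => x _; rewrite /cond_prefix (eq_bigl xpredT) ?P1 // => z.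
by rewrite !take0.
Qed.

(** * Estimates for base-two logarithms *)

Lemma log2M (R : realType) (a b : R) : 0 < a -> 0 < b ->
  log2 (a * b) = log2 a + log2 b.
Proof. by move=> a0 b0; rewrite /log2 lnM ?posrE // mulrDl. Qed.

Lemma ln2_gt0 (R : realType) : 0 < ln 2 :> R.
Proof. by rewrite ln_gt0 // ltr1n. Qed.

Lemma log2_exp (R : realType) j : log2 (2 ^+ j) = j%:R :> R.
Proof.
by rewrite /log2 lnXn // -[X in X / _]mulr_natl mulfK // gt_eqF // ln2_gt0.
Qed.

Lemma ler_log2 (R : realType) (a b : R) : 0 < a -> a <= b -> log2 a <= log2 b.
Proof.
move=> a0 ab; rewrite /log2 ler_pM2r ?invr_gt0 ?ln2_gt0 // ler_ln ?posrE //.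
exact: lt_le_trans a0 ab.
Qed.

(** Turns multiplicative bounds on a ratio r into additive ones. Absolute values appear since a and
    b may be below 1. *)
Lemma log2_near (R : realType) (a b r : R) j : 0 < a -> 0 < b ->
  2 ^+ j <= a * r -> r <= b * 2 ^+ j ->
  eq_upto (`|log2 a| + `|log2 b|) (log2 r) j%:R.
Proof.
move=> a0 b0 lo hi; have e0 : 0 < 2 ^+ j :> R by rewrite exprn_gt0.
have r0 : 0 < r by rewrite -(pmulr_rgt0 _ a0); apply: lt_le_trans e0 lo.
have := ler_log2 e0 lo; have := ler_log2 r0 hi.
rewrite !log2M // log2_exp /eq_upto => hi' lo'.
have := ler_norm (log2 a); have := ler_norm (log2 b).
by have := normr_ge0 (log2 a); have := normr_ge0 (log2 b); rewrite ler_norml; lra.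
Qed.

(** From 2^(l-1) <= n <= 2^l, the padding length l is within 1 of log n. *)
Lemma log2_blank (R : realType) n : (0 < n)%N ->
  eq_upto 1 (free_len n)%:R (n%:R - log2 n%:R : R).
Proof.
move=> n0; have nR : 0 < n%:R :> R by rewrite ltr0n.
have /andP[lo hi] := up_log_bounds (isT : 1 < 2)%N (n0 : 1 < n.+1)%N.
have lo' : 2 ^+ (blank n).-1 <= n%:R :> R by rewrite -natrX ler_nat.
have hi' : n%:R <= 2 ^+ blank n :> R by rewrite -natrX ler_nat ltnW.
have := ler_log2 (exprn_gt0 _ (ltr0n R 2)) lo'; have := ler_log2 nR hi'.
rewrite !log2_exp /eq_upto natrB ?blank_le // => h1.
by case: (blank n) h1 => [|l] /=; rewrite -?(natr1 R l) ler_norml; lra.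
Qed.

(** * Complexity of the pairs, counting and averaging *)

Lemma npair_injl a b a' b' : npair a b = npair a' b' -> a = a'.
Proof.
move=> /(congr1 (logn 2)); rewrite !lognM ?expn_gt0 // !pfactorK //.
have odd2 c : logn 2 c.*2.+1 = 0%N.
  by apply: logn_coprime; rewrite coprime2n /= odd_double.
by rewrite !odd2 !addn0.
Qed.

Lemma lead_lag_complexity U : optimal U -> exists c, forall n (u : word (free_len n)),
  (exists2 q, machine U q n (npair (bcode (lead u)) (bcode (lag u))) &
     (size q <= free_len n + c)%N) /\
  (exists2 q, machine U q n (npair (bcode (lag u)) (bcode (lead u))) &
     (size q <= free_len n + c)%N).
Proof.
move=> hU.
pose X b n := (b * 2 ^ blank n)%N; pose Y b n := (2 ^ n + b - 2 ^ free_len n)%N.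
have hX : recursive2 X.
  apply: (recursive_app2 recursive_mul (recursive_nth 0)).
  exact: recursive_exp (recursive_app1 recursive_blank (recursive_nth 1)).
have hY : recursive2 Y.
  apply: (recursive_app2 recursive_sub).
    apply: (recursive_app2 recursive_add _ (recursive_nth 0)).
    exact: recursive_exp (recursive_nth 1).
  exact: recursive_exp (recursive_free_len (recursive_nth 1)).
have [c1 h1] := free_complexity (F := fun b n => npair (X b n) (Y b n)) hU
  (recursive_app2 recursive_npair hX hY).
have [c2 h2] := free_complexity (F := fun b n => npair (Y b n) (X b n)) hU
  (recursive_app2 recursive_npair hY hX).
exists (c1 + c2)%N => n u; rewrite bcode_lead bcode_lag.
have [q1 m1 s1] := h1 n u; have [q2 m2 s2] := h2 n u.
split; [exists q1 | exists q2] => //.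
  by rewrite addnA; apply: leq_trans s1 (leq_addr _ _).
by rewrite addnCA; apply: leq_trans s2 (leq_addl _ _).
Qed.

(** At most 2^(j-3) words have complexity below j - 3, so a penalty of 8 on each still averages to
    at most 1. *)
Lemma card_compressible (R : realType) U n j (code : word j -> nat) :
  injective code -> (forall u, exists p, machine U p n (code u)) ->
  \sum_(u : word j) 8 * (min_length [set p | machine U p n (code u)] + 3 < j)%:R
    <= 2 ^+ j :> R.
Proof.
(* For j < 3 the exponent j - 3 would be truncated, but then no word is penalised. *)
move=> cinj hp; have [j3|j3] := leqP 3 j; last first.
  rewrite big1 ?exprn_ge0 // => u _; rewrite ltnNge (leq_trans (ltnW j3)) ?leq_addl //.
  by rewrite mulr0.
have -> : 2 ^+ j = 8 * (2 ^ (j - 3))%:R :> R.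
  by rewrite natrX -{1}(subnKC j3) exprD; congr (_ * _); ring.
rewrite -mulr_sumr ler_pM2l // -natr_sum ler_nat.
apply: leq_trans (card_short (n := n) (U := U) (j - 3) cinj hp).
rewrite -sum1_card [leqRHS]big_mkcond; apply: leq_sum => u _.
by rewrite inE ltn_subRL addnC; case: ifP.
Qed.

(** The slack 1 makes the contradiction strict: if every value exceeded the bound, the sum would be
    at least C + 1. *)
Lemma average_le (R : realType) j (F : word j -> R) C :
  \sum_u F u <= C -> exists u, F u <= (C + 1) / 2 ^+ j.
Proof.
move=> FC; apply: contrapT => /forallNP h.
have : \sum_(u : word j) (C + 1) / 2 ^+ j <= C.
  by apply: le_trans FC; apply: ler_sum => u _; rewrite ltW // ltNge; apply/negP.
rewrite sum_words mulrC divfK ?expf_neq0 ?pnatr_eq0 //; lra.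
Qed.

(** * The common statistic *)

(** A count and not an indicator: a pair may lie in both supports, as the two zero words do. *)
Definition pcount n a b : nat :=
  ((test_lead n a && test_delay n a b) + (test_lead n b && test_delay n b a))%N.

Definition pdist (R : realType) n (z : word n * word n) : R :=
  (pcount n (bcode z.1) (bcode z.2))%:R / 2 ^+ (free_len n).+1.

Lemma pdist_sym (R : realType) n (x y : word n) : pdist R (x, y) = pdist R (y, x).
Proof. by rewrite /pdist /pcount addnC. Qed.

Lemma sum_pdist (R : realType) n : \sum_(z : word n * word n) pdist R z = 1.
Proof.
pose pr (u : word (free_len n)) := (lead u, lag u).
have prinj : injective pr by move=> u v [/lead_inj].
pose swap (z : word n * word n) := (z.2, z.1).
have swapK : involutive swap by case.
have E : \sum_(z : word n * word n) (z \in codom pr)%:R = 2 ^+ free_len n :> R.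
  exact: sum_codom.
transitivity ((\sum_(z : word n * word n) (z \in codom pr)%:R +
               \sum_(z : word n * word n) (swap z \in codom pr)%:R) /
              2 ^+ (free_len n).+1 : R).
  rewrite -big_split mulr_suml; apply: eq_bigr => -[x y] _.
  by rewrite /pdist /pcount natrD /swap /pr !codom_lead_lag.
rewrite [X in _ + X](reindex_inj (inv_inj swapK)) /=.
under [X in _ + X]eq_bigr => z _ do rewrite swapK.
by rewrite E exprS mulr_natl mulr2n divff // gt_eqF // addr_gt0 // exprn_gt0.
Qed.

(** One program serves all n, which is what bounds [KP] by a constant. *)
Lemma pdist_program (R : realType) : exists e, forall n, computes_dist e (@pdist R n).
Proof.
pose F s := pcount (nth 0%N s 0) (nth 0%N s 2) (nth 0%N s 3).
have hF : recursive F.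
  have hl i := recursive_app2 recursive_test_lead (recursive_nth 0) (recursive_nth i).
  have hd i := recursive_test_delay (recursive_nth 0) (recursive_nth i).
  apply: (recursive_app2 recursive_add); apply: recursive_andb => //;
    exact: hd (recursive_nth _).
(* Rounding the probability times 2^k down to an integer loses less than 1, so the error is below
   2^-k, with k here the precision. *)
pose G s := (F s * 2 ^ nth 0 s 1 %/ 2 ^ (free_len (nth 0 s 0)).+1)%N.
have [e he] : recursive G.
  apply: (recursive_app2 recursive_div2).
    exact: (recursive_app2 recursive_mul hF (recursive_exp (recursive_nth 1))).
  exact: (recursive_app1 recursive_succ (recursive_free_len (recursive_nth 0))).
exists e => n x y k; exists (G [:: n, k & pair_args (x, y)]) => //.
rewrite /pdist /G /F /=; set c := pcount _ _ _; set d := (free_len n).+1.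
have d0 : 0 < 2 ^+ d :> R by rewrite exprn_gt0.
have k0 : 0 < 2 ^+ k :> R by rewrite exprn_gt0.
have := divn_eq (c * 2 ^ k) (2 ^ d).
have := ltn_pmod (c * 2 ^ k) (expn_gt0 2 d : (0 < _)%N).
set a := (_ %/ _)%N; set r := (_ %% _)%N => rd /(congr1 (fun v => v%:R : R)).
rewrite natrD !natrM !natrX => E.
have -> : c%:R / 2 ^+ d - a%:R / 2 ^+ k = r%:R / (2 ^+ d * 2 ^+ k) :> R.
  rewrite -[r%:R](addKr (a%:R * 2 ^+ d)) -E; field.
  by rewrite !gt_eqF.
rewrite ger0_norm ?divr_ge0 ?mulr_ge0 ?(ltW d0) ?(ltW k0) //.
rewrite invfM mulrA ler_piMl ?invr_ge0 ?(ltW k0) // ler_pdivrMr // mul1r.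
by rewrite -natrX ler_nat ltnW.
Qed.

Lemma pdist_computable (R : realType) n : computable_dist (@pdist R n).
Proof.
have [e he] := pdist_program R; split; last by exists e.
  by move=> z; rewrite divr_ge0 // exprn_ge0.
exact: sum_pdist.
Qed.

Lemma KP_pdist (R : realType) U : optimal U ->
  exists c, forall n, (KP U (@pdist R n) <= c)%N.
Proof.
move=> hU; have [e he] := pdist_program R.
have [c hc] := const_complexity hU (godel e).
exists c => n; have [q hq sq] := hc n.
have Aq : [set p | exists2 e, machine U p n (godel e) & computes_dist e (@pdist R n)] q.
  by exists e.
by have [_ h] := min_lengthP Aq; apply: leq_trans (h _ Aq) sq.
Qed.

(** On the support the count is 1 or 2, over the denominator 2^(k+1). *)
Lemma log2_pdist (R : realType) n (u : word (free_len n)) :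
  0 < pdist R (lead u, lag u) /\
  - (free_len n)%:R - 1 <= log2 (pdist R (lead u, lag u)) <= - (free_len n)%:R.
Proof.
set k := free_len n.
have : test_lead n (bcode (lead u)) && test_delay n (bcode (lead u)) (bcode (lag u)).
  by rewrite -codom_lead_lag codom_f.
rewrite /pdist /pcount /= => ->; set b : bool := _ && _.
have k0 : 0 < 2 ^+ k.+1 :> R by rewrite exprn_gt0.
have p0 : 0 < (true + b)%:R / 2 ^+ k.+1 :> R by rewrite divr_gt0 // ltr0n.
split=> //; set p := _ / _ in p0 *.
have pE : p * 2 ^+ k.+1 = (true + b)%:R by rewrite /p divfK // gt_eqF.
have lo : 2 ^+ 0 <= p * 2 ^+ k.+1 by rewrite pE expr0 ler1n.
have hi : p * 2 ^+ k.+1 <= 2 ^+ 1 by rewrite pE expr1 ler_nat; case: b {p p0 pE lo}.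
have := ler_log2 (exprn_gt0 _ (ltr0n R 2)) lo.
have := ler_log2 (mulr_gt0 p0 k0) hi; rewrite !log2M // !log2_exp -[k.+1]addn1 natrD.
lra.
Qed.

(** * Existence of a typical u and the resulting transfers *)

Lemma sum_inj_le (R : realType) (T S : finType) (f : T -> S) (G : S -> R) :
  injective f -> (forall z, 0 <= G z) -> \sum_t G (f t) <= \sum_z G z.
Proof.
move=> finj G0.
rewrite -(@big_imset _ _ _ _ _ f xpredT G) /=; last by move=> t s _ _ /finj.
by rewrite big_mkcond; apply: ler_sum => z _; case: ifP.
Qed.

(** Two semimeasure values and two penalties for compressibility each sum to at most 1 over u, so a
    single u makes all four small at once. *)
Lemma exists_typical (R : realType) U (m : forall n, word n -> R)
    (mc : forall n, word n * word n -> R) n :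
  optimal U -> semimeasure m -> cond_semimeasure mc -> causal mc ->
  exists u : word (free_len n),
    [/\ mc n (lead u, lag u) <= 5 / 2 ^+ free_len n,
        m n (lag u) <= 5 / 2 ^+ free_len n,
        (free_len n <= K2 U (lead u) (lag u) + 3)%N &
        (free_len n <= K2 U (lag u) (lead u) + 3)%N].
Proof.
move=> hU [m0 m1] mcs mcc; have [mc0 _] := mcs; have [c hc] := lead_lag_complexity hU.
set k := free_len n; have k0 : 0 < 2 ^+ k :> R by rewrite exprn_gt0.
pose b1 (u : word k) : R := (K2 U (lead u) (lag u) + 3 < k)%:R.
pose b2 (u : word k) : R := (K2 U (lag u) (lead u) + 3 < k)%:R.
pose F (u : word k) : R :=
  mc n (lead u, lag u) + m n (lag u) + 8 * b1 u / 2 ^+ k + 8 * b2 u / 2 ^+ k.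
have : \sum_u F u <= 1 + 1 + 1 + 1.
  rewrite !big_split /= !lerD //.
  (* [causal_sum_le1] lets the condition use the current bit too, so strict delay is more than
     enough; the words u 0^l give only part of its sum. *)
  - have dc (i : nat) (x x' : word n) : (i < n)%N ->
      take i x = take i x' -> take i (delay x) = take i (delay x').
      case: i => [|i] lt E; first by rewrite !take0.
      apply: take_delay; first exact: ltnW lt.
      by rewrite /= -(take_takel x (leqnSn i)) E take_takel.
    apply: le_trans (causal_sum_le1 mcs mcc dc).
    under eq_bigr => u _ do rewrite -delay_lead.
    exact: (sum_inj_le (G := fun x => mc n (x, delay x)) (@lead_inj n)).
  - exact: le_trans (sum_inj_le (@lag_inj n) (m0 n)) (m1 n).
  - rewrite -mulr_suml ler_pdivrMr // mul1r.
    apply: (card_compressible _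
      (code := fun u => npair (bcode (lead u)) (bcode (lag u)))).
      by move=> u v /npair_injl/bcode_inj/val_inj/lead_inj.
    by move=> u; have [[q hq _] _] := hc n u; exists q.
  - rewrite -mulr_suml ler_pdivrMr // mul1r.
    apply: (card_compressible _
      (code := fun u => npair (bcode (lag u)) (bcode (lead u)))).
      by move=> u v /npair_injl/bcode_inj/val_inj/lag_inj.
    by move=> u; have [_ [q hq _]] := hc n u; exists q.
move=> /average_le[u]; rewrite (_ : 1 + 1 + 1 + 1 + 1 = 5) /F; last by ring.
have := mc0 n (lead u, lag u); have := m0 n (lag u).
have b10 : 0 <= 8 * b1 u / 2 ^+ k by rewrite !mulr_ge0 ?ler0n ?invr_ge0 ?(ltW k0).
have b20 : 0 <= 8 * b2 u / 2 ^+ k by rewrite !mulr_ge0 ?ler0n ?invr_ge0 ?(ltW k0).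
move=> hm hmc hF; exists u; split; [lra | lra | |]; rewrite leqNgt; apply/negP => bad.
(* A compressible pair would contribute 8 / 2^k, above the total bound 5 / 2^k, where 5 is four sums
   plus the slack. *)
- have : 8 * b1 u / 2 ^+ k <= 5 / 2 ^+ k by lra.
  by rewrite /b1 bad ler_pM2r ?invr_gt0 // -natrM ler_nat.
- have : 8 * b2 u / 2 ^+ k <= 5 / 2 ^+ k by lra.
  by rewrite /b2 bad ler_pM2r ?invr_gt0 // -natrM ler_nat.
Qed.

Theorem proposition4p2 (R : realType) (U : prog)
    (m : forall n : nat, word n -> R)
    (mc : forall n : nat, word n * word n -> R)
    (hU : optimal U)
    (hm : universal (@enum_semimeasures R) m)
    (hmc : universal (@enum_causal_semimeasures R) mc) :
  exists (c : R) (e : R -> R), forall n : nat, (0 < n)%N ->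
    exists (x y x' y' : word n) (P : word n * word n -> R),
      [/\ minimal_sufficient U c e x y P,
          minimal_sufficient U c e x' y' P,
          eq_upto c (EIT m mc x y) 0 /\
          eq_upto c (EIT m mc x' y') (n%:R - log2 n%:R) &
          eq_upto c (EIT m mc y x) (n%:R - log2 n%:R) /\
          eq_upto c (EIT m mc y' x') 0].
Proof.
have [[ms _] _] := hm; have [[mcs mcc _] _] := hmc.
have [mc0 mc1] := mcs; have [m0 _] := ms.
have [kp hkp] := KP_pdist R hU.
have [kc hkc] := lead_lag_complexity hU.
have [a a0 ha] := universal_uniform hm (@lead_inj) recursive_test_lead test_leadP.
have [b b0 hb] := universal_uniform hm (@lag_inj) recursive_test_lag test_lagP.
have [d d0 hd] := universal_delay hmc.
have [g g0 hg] := universal_unconditional hm hmc.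
pose c1 : R := `|log2 g| + `|log2 (5 * a)|.
pose c2 : R := `|log2 (5 * d)| + `|log2 b| + 1.
(* [c1] and [c2] serve the two transfers. For sufficiency, [kp] and [kc] bound the descriptions, and
   4 is 1 for the mixture plus 3 for incompressibility. *)
pose c : R := c1 + c2 + (kp + kc)%:R + 4.
have c10 : 0 <= c1 by rewrite addr_ge0.
have c20 : 0 <= c2 by rewrite !addr_ge0.
(* Minimality costs at most [kp] against any statistic, since complexities are nonnegative; the
   constant does not depend on d. *)
exists c, (fun=> kp%:R) => n n0.
have [u [mcxy my Kxy Kyx]] := exists_typical n hU ms mcs mcc.
set k := free_len n in u mcxy my Kxy Kyx.
have k0 : 0 < 2 ^+ k :> R by rewrite exprn_gt0.
have weaken c' r s : c' <= c -> eq_upto c' r s -> eq_upto c r s.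
  by rewrite /eq_upto => cc h; apply: le_trans h cc.
have kpkc : 0 <= (kp + kc)%:R :> R by rewrite ler0n.
have minimal (x y : word n) q : pdist R (x, y) = pdist R (lead u, lag u) ->
    (k <= K2 U x y + 3)%N -> machine U q n (npair (bcode x) (bcode y)) ->
    (size q <= k + kc)%N ->
    minimal_sufficient U c (fun=> kp%:R) x y (@pdist R n).
  move=> pE Klo hq sq; split; last first.
    by move=> _ Q _; apply: le_trans (_ : kp%:R <= _); rewrite ?ler_nat ?hkp // lerDr.
  have [p0 /andP[]] := log2_pdist R u; rewrite -/k => plo phi; split; rewrite ?pE //.
    exact: pdist_computable.
  have Khi : (K2 U x y <= k + kc)%N.
    have [_ h] := @min_lengthP [set p | machine U p n (npair (bcode x) (bcode y))] q hq.
    exact: leq_trans (h _ hq) sq.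
  have := hkp n; rewrite -(ler_nat R) => kpR.
  have := ler0n R (KP U (@pdist R n)); have := ler0n R kp; have := ler0n R kc.
  move: Klo Khi; rewrite -!(ler_nat R) !natrD => Klo Khi kc0 kp0 KP0.
  rewrite /eq_upto /c natrD ler_norml; apply/andP; split; lra.
have mx0 : 0 < m n (lead u).
  have := ha n u; rewrite mulrCA => h.
  by rewrite -(pmulr_lgt0 _ (mulr_gt0 a0 k0)); apply: lt_le_trans h.
have my0 : 0 < m n (lag u).
  have := hb n u; rewrite mulrCA => h.
  by rewrite -(pmulr_lgt0 _ (mulr_gt0 b0 k0)); apply: lt_le_trans h.
have EITxy : eq_upto c (EIT m mc (lead u) (lag u)) 0.
  apply: weaken (_ : c1 <= c) _; first by rewrite /c; lra.
  (* The ratio is at least 1/g because [mc] dominates m, and at most 5a because mc(x|y) <= 5 / 2^k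
     while 2^-k <= a m(x). *)
  apply: (@log2_near _ _ _ _ 0%N) => //; rewrite ?mulr_gt0 // expr0.
    by rewrite mulrA ler_pdivlMr // mul1r; apply: hg.
  rewrite mulr1 ler_pdivrMr //; apply: le_trans mcxy _.
  rewrite ler_pdivrMr // -!mulrA ler_pMr //; exact: ha.
have EITyx : eq_upto c (EIT m mc (lag u) (lead u)) (n%:R - log2 n%:R).
  apply: weaken (_ : c2 <= c) _; first by rewrite /c; lra.
  suff h : eq_upto (`|log2 (5 * d)| + `|log2 b|) (EIT m mc (lag u) (lead u)) k%:R.
    have := log2_blank R n0; move: h; rewrite /eq_upto /c2 -/k => h1 h2.
    apply: le_trans (lerD h1 h2); apply: le_trans (ler_normD _ _).
    by rewrite addrA subrK.
  (* Below: m(y) <= 5 / 2^k and 1 <= d mc(y|x). Above: mc(y|x) <= 1, being one term of a sum at most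
     1, and 2^-k <= b m(y). *)
  apply: log2_near => //; rewrite ?mulr_gt0 //.
    have := hd n (lead u); rewrite delay_lead => h.
    rewrite mulrA ler_pdivlMr //.
    move: my; rewrite ler_pdivlMr // mulrC => my; apply: le_trans my _.
    by rewrite -mulrA ler_pMr.
  rewrite ler_pdivrMr //; apply: le_trans (_ : 1 <= _).
    have := mc1 n (lead u); rewrite (bigD1 (lag u)) //=; apply: le_trans.
    by rewrite lerDl sumr_ge0.
  by rewrite -mulrA [2 ^+ k * _]mulrC; apply: hb.
have [[q hq sq] [q' hq' sq']] := hkc n u.
exists (lead u), (lag u), (lag u), (lead u), (@pdist R n); split=> //.
- exact: minimal hq sq.
- by apply: minimal hq' sq' => //; rewrite pdist_sym.
Qed.
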